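(* Let $\alpha,\beta,\gamma,\delta$ be real constants with $\alpha>0$ and $\delta>0$, and assume that $\max(\beta,\gamma)\geq 0$ or $\beta\gamma<\alpha\delta$. Then $x(t)=c\sqrt t$, $y(t)=d\sqrt t$, with $$c=\Big(2\alpha+\tfrac{\beta}{\delta}\big(\beta-\gamma+\sqrt{(\beta-\gamma)^2+4\alpha\delta}\big)\Big)^{1/2},\qquad d=\Big(2\delta+\tfrac{\gamma}{\alpha}\big(\gamma-\beta+\sqrt{(\beta-\gamma)^2+4\alpha\delta}\big)\Big)^{1/2},$$ is the unique solution on $[0,\infty)$ to the integral system started at $(0,0)$, $$x(t)=\alpha\int_0^t\frac{ds}{x(s)}+\beta\int_0^t\frac{ds}{y(s)},\qquad y(t)=\gamma\int_0^t\frac{ds}{x(s)}+\delta\int_0^t\frac{ds}{y(s)},\qquad t\geq 0.$$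
   Context: A solution to the integral system is a pair of continuous functions $x(\cdot),y(\cdot):[0,\infty)\to[0,\infty)$ satisfying the two equations for all $t\geq0$ and such that for every $t\geq 0$: the sets $\{s\in[0,t]:x(s)=0\}$ and $\{s\in[0,t]:y(s)=0\}$ have Lebesgue measure zero, and $\int_0^t \mathbf 1_{\{x(s)>0\}}\frac{ds}{x(s)}<\infty$, $\int_0^t \mathbf 1_{\{y(s)>0\}}\frac{ds}{y(s)}<\infty$. Under the stated assumptions the quantities under the exponent $1/2$ are positive, so $c,d>0$. *)

(* Defs.v *)
From HB Require Import structures.
From mathcomp Require Import all_boot all_order all_algebra.
From mathcomp Require Import all_classical all_reals all_analysis.

Set Implicit Arguments.
Unset Strict Implicit.
Unset Printing Implicit Defensive.

Import Order.TTheory GRing.Theory Num.Theory.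
Import numFieldNormedType.Exports.

Local Open Scope classical_set_scope.
Local Open Scope ring_scope.

(* Only the restrictions of [x] and [y] to [0, +oo[ are constrained.  In the
   two equations the integrals are real-valued Lebesgue integrals; since
   [0^-1 = 0], their integrands are the indicator-weighted ones of
   [sol_int_x] and [sol_int_y], which are required to have finite integral,
   so that [Rintegral] does not truncate an infinite value. *)
Record is_solution (R : realType) (alpha beta gamma delta : R)
    (x y : R -> R) : Prop := IsSolution {
  sol_cont_x : {within `[0, +oo[, continuous x};
  sol_cont_y : {within `[0, +oo[, continuous y};
  sol_ge0_x : forall t : R, 0 <= t -> 0 <= x t;
  sol_ge0_y : forall t : R, 0 <= t -> 0 <= y t;
  sol_zero_x : forall t : R, 0 <= t ->
    lebesgue_measure (`[0, t] `&` [set s | x s = 0]) = 0%E;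
  sol_zero_y : forall t : R, 0 <= t ->
    lebesgue_measure (`[0, t] `&` [set s | y s = 0]) = 0%E;
  sol_int_x : forall t : R, 0 <= t ->
    (\int[lebesgue_measure]_(s in `[0%R, t])
       ((\1_[set r | 0 < x r] s / x s)%R)%:E < +oo)%E;
  sol_int_y : forall t : R, 0 <= t ->
    (\int[lebesgue_measure]_(s in `[0%R, t])
       ((\1_[set r | 0 < y r] s / y s)%R)%:E < +oo)%E;
  sol_eq_x : forall t : R, 0 <= t ->
    x t = alpha * (\int[lebesgue_measure]_(s in `[0, t]) (x s)^-1)
        + beta * (\int[lebesgue_measure]_(s in `[0, t]) (y s)^-1);
  sol_eq_y : forall t : R, 0 <= t ->
    y t = gamma * (\int[lebesgue_measure]_(s in `[0, t]) (x s)^-1)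
        + delta * (\int[lebesgue_measure]_(s in `[0, t]) (y s)^-1)
}.

(* [Num.sqrt] is [0] on negative arguments; under the hypotheses on the four
   constants all the radicands below are positive. *)
Definition coef_c (R : realType) (alpha beta gamma delta : R) : R :=
  Num.sqrt (2 * alpha + beta / delta *
    (beta - gamma + Num.sqrt ((beta - gamma) ^+ 2 + 4 * alpha * delta))).

Definition coef_d (R : realType) (alpha beta gamma delta : R) : R :=
  Num.sqrt (2 * delta + gamma / alpha *
    (gamma - beta + Num.sqrt ((beta - gamma) ^+ 2 + 4 * alpha * delta))).

(* Main.v *)
(* Put U(t) = int_0^t ds/x and V(t) = int_0^t ds/y. In the time scale dt/(xy) the
   system is linear in (U, V); its eigenvalues are l and m, with m < l, and the
   hypothesis on the constants says exactly that l > 0. Let (1, w) be the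
   eigenvector of l; then w > 0. The two left eigenvectors give P = V - w U and
   Q = delta V + (alpha / w) U, with P' = m P / (xy) and Q' = l Q / (xy) almost
   everywhere, and P(0) = Q(0) = 0. Uniqueness amounts to P = 0, since then
   x = l w U, hence (U^2)' = 2 / (l w).
   If m <= 0, then P' and P have opposite signs, so P cannot leave 0.
   If m > 0, then beta, gamma > 0, so x and y are positive for t > 0, and P / Q is
   bounded; for n large (P / Q)^(2n) Q is nonincreasing and tends to 0 at 0. *)
Require Import Defs.
From HB Require Import structures.
From mathcomp Require Import all_boot all_order all_algebra.
From mathcomp Require Import all_classical all_reals all_analysis.
From mathcomp Require Import measurable_realfun ring lra.

Import Order.TTheory GRing.Theory Num.Theory.
Import numFieldNormedType.Exports.

Local Open Scope classical_set_scope.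
Local Open Scope ring_scope.

(** * Spectral data of the linear system *)

(** The matrix of the system in (U, V) has trace [beta + gamma] and discriminant [D], so l = (beta +
    gamma + r) / 2 is its larger eigenvalue and w = (l - gamma) / delta. The radicands of [coef_c]
    and [coef_d] are then 2 (alpha + beta w) = 2 l w and 2 (delta + gamma / w) = 2 l / w. *)
Lemma coef_eigen (R : realType) (alpha beta gamma delta : R) :
  0 < alpha -> 0 < delta ->
  0 <= Num.max beta gamma \/ beta * gamma < alpha * delta ->
  exists w l : R, [/\ 0 < w, 0 < l, alpha + beta * w = l * w,
    gamma + delta * w = l &
    coef_c alpha beta gamma delta = Num.sqrt (2 * (l * w)) /\
    coef_d alpha beta gamma delta = Num.sqrt (2 * (l / w))].
Proof.
move=> a0 d0 hyp.
have ad0 : 0 < alpha * delta by rewrite mulr_gt0.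
set D := (beta - gamma) ^+ 2 + 4 * alpha * delta.
have D0 : 0 < D by rewrite ltr_wpDl ?sqr_ge0 // -mulrA mulr_gt0.
set r := Num.sqrt D.
have r0 : 0 < r by rewrite sqrtr_gt0.
have rE : r ^+ 2 = D by rewrite sqr_sqrtr // ltW.
(* Since alpha delta > 0, [r] exceeds |beta - gamma|. *)
have s0 : 0 < beta - gamma + r by rewrite /D in rE; nra.
(* If beta >= 0, then r > beta - gamma makes the sum exceed 2 beta; likewise for gamma. In the other
   case of [hyp], r^2 - (beta + gamma)^2 = 4 (alpha delta - beta gamma) > 0. *)
have l0 : 0 < beta + gamma + r.
  rewrite /D in rE; case: hyp => [|h]; last by nra.
  by rewrite le_max => /orP[h|h]; nra.
have w0 : 0 < (beta - gamma + r) / (2 * delta) by rewrite divr_gt0 ?mulr_gt0.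
have dn0 : delta != 0 by rewrite gt_eqF.
have an0 : alpha != 0 by rewrite gt_eqF.
have sn0 : beta - gamma + r != 0 by rewrite gt_eqF.
have quad : alpha + beta * ((beta - gamma + r) / (2 * delta)) =
    (beta + gamma + r) / 2 * ((beta - gamma + r) / (2 * delta)).
  apply: (mulfI dn0); apply/eqP; rewrite -subr_eq0; apply/eqP.
  have -> : delta * (alpha + beta * ((beta - gamma + r) / (2 * delta))) -
    delta * ((beta + gamma + r) / 2 * ((beta - gamma + r) / (2 * delta))) =
    (D - r ^+ 2) / 4 by rewrite /D; field.
  by rewrite rE subrr mul0r.
exists ((beta - gamma + r) / (2 * delta)), ((beta + gamma + r) / 2); split => //.
- by rewrite divr_gt0.
- by field.
- rewrite /coef_c /coef_d -/D -/r; split; congr Num.sqrt.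
    by rewrite -quad; field.
  rewrite invf_div -[beta + gamma + r]/(beta + gamma + r).
  (* This product of conjugates turns 1 / w into (gamma - beta + r) / (2 alpha), the form occurring
     in [coef_d]. *)
  have qE : (gamma - beta + r) * (beta - gamma + r) = 4 * alpha * delta.
    transitivity (r ^+ 2 - (beta - gamma) ^+ 2); first by ring.
    by rewrite rE /D; ring.
  have -> : gamma - beta + r = 4 * alpha * delta / (beta - gamma + r).
    by rewrite -qE mulfK.
  by field; rewrite an0 sn0.
Qed.

(** * Two facts on integrals over [0, t] *)

(** The integrand is unbounded near 0, so the fundamental theorem is applied on intervals shrinking
    away from 0, followed by monotone convergence. *)
Lemma integral_inv_sqrt (R : realType) (c t : R) : 0 < c -> 0 <= t ->
  (\int[lebesgue_measure]_(s in `[0%R, t]) ((c * Num.sqrt s)^-1)%:E)%E =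
  (2 / c * Num.sqrt t)%:E.
Proof.
move=> c0; rewrite le_eqVlt => /predU1P[<-|t0].
  by rewrite set_itv1 integral_set1 sqrtr0 mulr0.
set f := fun s : R => (c * Num.sqrt s)^-1.
(* With [n.+2] the left endpoint is strictly below t already at n = 0. *)
pose F n := `[t / n.+2%:R, t]%classic.
have an0 n : 0 < t / n.+2%:R by rewrite divr_gt0.
have an1 n : t / n.+2%:R < t by rewrite gtr_pMr// invf_lt1// ltr1n.
have fcont s : 0 < s -> {for s, continuous f}.
  move=> s0; apply: continuousV; first by rewrite gt_eqF// mulr_gt0// sqrtr_gt0.
  by apply: continuousM; [exact: cst_continuous|exact: sqrt_continuous].
have fcw n : {within F n, continuous f}.
  apply: continuous_in_subspaceT => s /set_mem.
  rewrite /F /= in_itv /= => /andP[h _]; by apply: fcont; apply: lt_le_trans h.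
have UF : \bigcup_n F n = `]0, t]%classic.
  apply/seteqP; split => s.
    move=> [n _]; rewrite /F /= !in_itv/= => /andP[h ->]; by rewrite (lt_le_trans _ h).
  rewrite /= in_itv/= => /andP[s0 st].
  exists (Num.truncn (t / s)) => //; rewrite /F /= in_itv/= st andbT.
  rewrite ler_pdivrMr// mulrC -ler_pdivrMr//.
  apply/ltW/(lt_le_trans (truncnS_gt _)); by rewrite ler_nat.
have ndF : nondecreasing_seq F.
  apply/nondecreasing_seqP => n; apply/subsetPset => s.
  rewrite /F /= !in_itv/= => /andP[h ->]; rewrite andbT (le_trans _ h)//.
  by rewrite ler_pM2l// lef_pV2 ?posrE// ler_nat.
have mf n : measurable_fun (F n) f.
  by apply: subspace_continuous_measurable_fun; [exact: measurable_itv|exact: fcw].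
have mf0 : measurable_fun `]0, t]%classic f.
  by rewrite -UF; apply/measurable_fun_bigcup => // n; exact: measurable_itv.
have intF n : (\int[lebesgue_measure]_(s in F n) (f s)%:E =
    (2 / c * Num.sqrt t - 2 / c * Num.sqrt (t / n.+2%:R))%:E)%E.
  rewrite (@continuous_FTC2 _ f (fun s => 2 / c * Num.sqrt s))//; first exact: fcw.
    split=> [s||].
    - rewrite in_itv/= => /andP[h _]; have s0 := lt_trans (an0 n) h.
      by apply: derivableM => //; have := is_derive1_sqrt s0; case.
    - apply: cvg_at_right_filter; apply: cvgM; first exact: cvg_cst.
      exact: sqrt_continuous.
    - apply: cvg_at_left_filter; apply: cvgM; first exact: cvg_cst.
      exact: sqrt_continuous.
  move=> s; rewrite in_itv/= => /andP[h _]; have s0 := lt_trans (an0 n) h.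
  have ds := is_derive1_sqrt s0.
  rewrite derive1E deriveZ//= derive_sqrt// /f /GRing.scale/=.
  by field; rewrite !gt_eqF// sqrtr_gt0.
rewrite -integral_itv_obnd_cbnd; last exact/measurable_EFinP.
rewrite -UF.
have cv1 : (\int[lebesgue_measure]_(s in F n) (f s)%:E)%E @[n --> \oo] -->
    (\int[lebesgue_measure]_(s in \bigcup_n F n) (f s)%:E)%E.
  apply: ge0_nondecreasing_set_cvg_integral => //.
  - by move=> n; rewrite /F; exact: measurable_itv.
  - by move=> n; apply/measurable_EFinP; exact: mf.
  - by move=> n s _ /=; rewrite lee_fin invr_ge0 mulr_ge0 ?sqrtr_ge0// ltW.
have cv2 : (\int[lebesgue_measure]_(s in F n) (f s)%:E)%E @[n --> \oo] -->
    (2 / c * Num.sqrt t)%:E.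
  under eq_fun do rewrite intF.
  apply: cvg_EFin; first by near=> n.
  (* The limit of t / (n + 2) is kept as t times 0, to match a product with the shifted harmonic
     sequence. *)
  suff : 2 / c * Num.sqrt t - 2 / c * Num.sqrt (t / n.+2%:R) @[n --> \oo] -->
      2 / c * Num.sqrt t - 2 / c * Num.sqrt (t * 0).
    by rewrite mulr0 sqrtr0 mulr0 subr0.
  apply: cvgB; first exact: cvg_cst.
  apply: cvgM; first exact: cvg_cst.
  apply: continuous_cvg; first exact: sqrt_continuous.
  apply: cvgM; first exact: cvg_cst.
  have := @cvg_harmonic R; rewrite -[X in X -> _]cvg_shiftS; exact.
exact: (cvg_unique _ cv1 cv2).
Unshelve. all: by end_near. Qed.

(** A substitute for the sign-of-derivative argument when the primitive is only differentiable
    almost everywhere; [N] collects the exceptional points, and continuity of the primitive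
    suffices. *)
Lemma Rintegral_le0_sign (R : realType) (f : R -> R) (N : set R) (T : R) :
  0 <= T -> lebesgue_measure.-integrable `[0, T] (EFin \o f) ->
  measurable N -> lebesgue_measure N = 0%E ->
  (forall s, 0 <= s <= T -> ~ N s ->
     0 < \int[lebesgue_measure]_(r in `[0, s]) f r -> f s <= 0) ->
  \int[lebesgue_measure]_(r in `[0, T]) f r <= 0.
Proof.
move=> T0 intf mN N0 sgn.
pose P s := \int[lebesgue_measure]_(r in `[0, s]) f r.
have contP := parameterized_integral_continuous T0 intf.
rewrite leNgt; apply/negP => PT.
pose S := `[0, T]%classic `&` P @^-1` [set y | y <= 0].
have clS : closed S.
  rewrite closed_setSI; last exact: interval_closed.
  by move/continuous_closedP : contP; apply; exact: closed_le.
have S0 : S 0.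
  by split => /=; rewrite ?in_itv/= ?lexx// /P set_itv1 Rintegral_set1.
have ubS : ubound S T by move=> s [] /=; rewrite in_itv/= => /andP[].
(* After [sup S], the last time at which [P <= 0], the integrand is nonpositive. *)
have [] : S (sup S).
  rewrite {1}(closure_id S).1//; apply: closure_sup; first by exists 0.
  by exists T.
rewrite /= in_itv/= => /andP[s0 sT] Ps.
have := @Rintegral_itvB _ f (BLeft 0) (BRight T) (sup S) intf.
rewrite !bnd_simp => /(_ s0 sT) itvB.
have sub : `]sup S, T]%classic `<=` `[0, T]%classic.
  by apply: subset_itvr; rewrite bnd_simp.
have intf' : lebesgue_measure.-integrable `]sup S, T] (EFin \o f).
  by apply: integrableS intf.
suff : \int[lebesgue_measure]_(r in `]sup S, T]) f r <= 0.
  by rewrite -itvB subr_le0 => /le_trans/(_ Ps); rewrite leNgt PT.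
have -> : \int[lebesgue_measure]_(r in `]sup S, T]) f r =
    \int[lebesgue_measure]_(r in `]sup S, T] `\` N) f r.
  by congr fine; apply: negligible_integral.
have mD : measurable (`]sup S, T] `\` N) by exact: measurableD.
have <- : \int[lebesgue_measure]_(r in `]sup S, T] `\` N) (cst 0 r : R) = 0.
  by rewrite Rintegral_cst// mul0r.
apply: le_Rintegral => //.
- by apply: integrableS intf' => //; exact: subDsetl.
- by apply: eq_integrable (integrable0 _ _).
move=> s [] /=; rewrite in_itv/= => /andP[ss sT'] nN.
apply: sgn => //.
  by rewrite sT' andbT (le_trans s0)// ltW.
rewrite ltNge; apply/negP => Ps'.
have : S s by split => //=; rewrite in_itv/= sT' (le_trans s0)// ltW.
by move/(ub_le_sup (ex_intro _ T ubS)); rewrite leNgt ss.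
Qed.

(** * The square-root pair as a solution *)

Lemma Rintegral_inv_sqrt (R : realType) (c t : R) : 0 < c -> 0 <= t ->
  \int[lebesgue_measure]_(s in `[0, t]) (c * Num.sqrt s)^-1 =
  2 / c * Num.sqrt t.
Proof. by move=> c0 t0; rewrite /Rintegral integral_inv_sqrt. Qed.

(** Both sides of each integral equation are multiples of sqrt t, so the system reduces to two
    algebraic relations between c and d. *)
Lemma is_solution_sqrt (R : realType) (alpha beta gamma delta c d : R) :
  0 < c -> 0 < d ->
  c = alpha * (2 / c) + beta * (2 / d) ->
  d = gamma * (2 / c) + delta * (2 / d) ->
  is_solution alpha beta gamma delta
    (fun t => c * Num.sqrt t) (fun t => d * Num.sqrt t).
Proof.
move=> c0 d0 cE dE.
have cont (a : R) : {within `[0, +oo[, continuous (fun t => a * Num.sqrt t)}.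
  apply: continuous_subspaceT => s.
  by apply: continuousM; [exact: cst_continuous|exact: sqrt_continuous].
have ge0 (a : R) : 0 < a -> forall t : R, 0 <= t -> 0 <= a * Num.sqrt t.
  by move=> a0 t _; rewrite mulr_ge0 ?sqrtr_ge0// ltW.
have zero (a : R) : 0 < a -> forall t : R, 0 <= t ->
    lebesgue_measure (`[0, t] `&` [set s | a * Num.sqrt s = 0]) = 0%E.
  move=> a0 t t0.
  suff -> : `[0, t] `&` [set s | a * Num.sqrt s = 0] = [set 0].
    exact: lebesgue_measure_set1.
  apply/seteqP; split => s /=; rewrite in_itv/=; last first.
    by move=> ->; rewrite lexx t0 sqrtr0 mulr0.
  move=> [/andP[s0 _] /eqP]; rewrite mulf_eq0 gt_eqF//= sqrtr_eq0 => s0'.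
  by apply/eqP; rewrite eq_le s0 s0'.
have int (a : R) : 0 < a -> forall t : R, 0 <= t ->
    (\int[lebesgue_measure]_(s in `[0%R, t])
      ((\1_[set r | 0 < a * Num.sqrt r] s / (a * Num.sqrt s))%R)%:E < +oo)%E.
  move=> a0 t t0.
  apply: (@le_lt_trans _ _ (2 / a * Num.sqrt t)%:E); last exact: ltry.
  rewrite -integral_inv_sqrt// le_eqVlt; apply/orP; left; apply/eqP.
  apply: eq_integral.
  move=> s _; congr EFin; rewrite indicE.
  have [h|h] := pselect (0 < a * Num.sqrt s).
    by rewrite mem_set// mul1r.
  have -> : a * Num.sqrt s = 0.
    by apply/eqP; rewrite eq_le mulr_ge0 ?sqrtr_ge0 ?(ltW a0)// andbT leNgt; apply/negP.
  by rewrite invr0 mulr0.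
split; try by [exact: cont|exact: ge0|exact: zero|exact: int].
- by move=> t t0; rewrite !Rintegral_inv_sqrt// {1}cE mulrDl !mulrA.
- by move=> t t0; rewrite !Rintegral_inv_sqrt// {1}dE mulrDl !mulrA.
Qed.

(** * Regularity of the primitive of 1/x along a solution *)

(** By this symmetry, everything proved for the primitive of 1/x also holds for that of 1/y. *)
Lemma is_solution_swap (R : realType) (alpha beta gamma delta : R) x y :
  is_solution alpha beta gamma delta x y ->
  is_solution delta gamma beta alpha y x.
Proof.
by case=> *; split => // t t0; rewrite addrC; auto.
Qed.

Lemma continuous_within_gt0 (R : realType) (x : R -> R) (t : R) :
  {within `[0, +oo[, continuous x} -> 0 < t -> {for t, continuous x}.
Proof.
move=> cx t0; have : {within `]0, +oo[, continuous x}.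
  by apply: continuous_subspaceW cx; apply: subset_itvr; rewrite bnd_simp.
rewrite continuous_open_subspace; last exact: interval_open.
by apply; rewrite inE/= in_itv/= t0.
Qed.

Section inverse_integral.
Context {R : realType} {alpha beta gamma delta : R} {x y : R -> R}.
Hypothesis sol : is_solution alpha beta gamma delta x y.
Let mu := @lebesgue_measure R.
Let U t := \int[mu]_(s in `[0, t]) (x s)^-1.

Lemma sol_measurable (t : R) : measurable_fun `[0, t] x.
Proof.
apply: subspace_continuous_measurable_fun; first exact: measurable_itv.
by apply: continuous_subspaceW (sol_cont_x sol); apply: subset_itvl.
Qed.

(* [powR 0 (-1) = 0 = 0^-1], so the inverse is measurable as a real power. *)
Lemma sol_inv_measurable (t : R) : measurable_fun `[0, t] (fun s => (x s)^-1).
Proof.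
apply: (@eq_measurable_fun _ _ _ _ _ (fun s => x s `^ (-1))).
  move=> s; rewrite inE/= in_itv/= => /andP[s0 _].
  by rewrite powR_inv1// (sol_ge0_x sol).
apply: (measurableT_comp (f := fun r : R => r `^ (-1))).
  exact: measurable_powR.
exact: sol_measurable.
Qed.

(** As x >= 0 and 0^-1 = 0, the absolute value of the integrand is the indicator-weighted function
    of [sol_int_x]. *)
Lemma sol_inv_integrable (t : R) : 0 <= t ->
  mu.-integrable `[0, t] (EFin \o (fun s => (x s)^-1)).
Proof.
move=> t0; apply/integrableP; split.
  by apply/measurable_EFinP; exact: sol_inv_measurable.
apply: le_lt_trans (sol_int_x sol t0).
rewrite le_eqVlt; apply/orP; left; apply/eqP; apply: eq_integral => s.
rewrite inE/= in_itv/= => /andP[s0 _].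
have xs0 := sol_ge0_x sol s0.
rewrite ger0_norm ?invr_ge0//; congr EFin; rewrite indicE.
move: xs0; rewrite le_eqVlt => /predU1P[<-|xs0]; first by rewrite invr0 mulr0.
by rewrite mem_set// mul1r.
Qed.

Lemma sol_inv_integral_ge0 t : 0 <= U t.
Proof.
apply: Rintegral_ge0 => s /=; rewrite in_itv/= => /andP[s0 _].
by rewrite invr_ge0 (sol_ge0_x sol).
Qed.

Lemma sol_zero_measurable (t : R) : measurable (`[0, t] `&` [set s | x s = 0]).
Proof.
have := @sol_measurable t (measurable_itv _) _ (measurable_set1 0); exact.
Qed.

(** If the integral were 0, then 1/x would vanish almost everywhere on [0, t]. It vanishes only at
    zeros of x, a null set, so [0, t] itself would be null. *)
Lemma sol_inv_integral_gt0 t : 0 < t -> 0 < U t.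
Proof.
move=> t0; rewrite lt_neqAle sol_inv_integral_ge0 andbT eq_sym.
apply/negP => /eqP Ut0.
have intf := sol_inv_integrable _ (ltW t0).
have : (\int[mu]_(s in `[0%R, t]) `|((x s)^-1)%:E| = 0)%E.
  transitivity (\int[mu]_(s in `[0%R, t]) ((x s)^-1)%:E)%E.
    apply: eq_integral => s; rewrite inE/= in_itv/= => /andP[s0 _].
    by rewrite ger0_norm// invr_ge0 (sol_ge0_x sol).
  rewrite -[LHS]fineK; last exact: integrable_fin_num.
  by rewrite -[fine _]/(U t) Ut0.
move/(ae_eq_integral_abs mu (measurable_itv _)) => /(_ _)[].
  by apply/measurable_EFinP; exact: sol_inv_measurable.
move=> N [mN N0 sub].
have nZ : mu.-negligible (`[0, t] `&` [set s | x s = 0]).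
  apply/negligibleP; last by apply: (sol_zero_x sol); exact: ltW.
  exact: sol_zero_measurable.
have nN : mu.-negligible N by apply/negligibleP.
have : mu.-negligible (`[0, t] : set R).
  apply: negligibleS (negligibleU nZ nN) => s st.
  have [xs|xs] := eqVneq (x s) 0; first by left.
  right; apply: sub => /= /(_ st) [] /eqP.
  by rewrite invr_eq0 (negbTE xs).
move/negligibleP => /(_ (measurable_itv _)) mu0.
have : lebesgue_measure (`[0, t] : set R) = 0%E by exact: mu0.
rewrite lebesgue_measure_itv/= lte_fin t0 oppr0 adde0 => -[] /eqP.
by rewrite gt_eqF.
Qed.

Lemma sol_inv_integral_derive (t : R) : 0 < t -> 0 < x t ->
  is_derive t 1 U (x t)^-1.
Proof.
move=> t0 xt0.
(* The larger interval [0, t + 1] has t in its interior, so the derivative is two-sided. *)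
have t10 : 0 <= t + 1 by rewrite addr_ge0// ltW.
have tt1 : t < t + 1 by rewrite ltrDl.
have [] := continuous_FTC1_closed tt1 (sol_inv_integrable _ t10) t0.
  apply: continuousV; first by rewrite gt_eqF.
  exact: continuous_within_gt0 _ _ _ (sol_cont_x sol) t0.
by move=> dU UE; split => //; rewrite -derive1E.
Qed.

Lemma sol_inv_integral_continuous (t : R) : 0 <= t -> {within `[0, t], continuous U}.
Proof.
by move=> t0; exact: parameterized_integral_continuous (sol_inv_integrable _ t0).
Qed.

Lemma sol_inv_integral0 : U 0 = 0.
Proof. by rewrite /U set_itv1 Rintegral_set1. Qed.

End inverse_integral.

(** * Uniqueness: proportionality of U and V, then the explicit form *)

Section ratio.
Context {R : realType} {alpha beta gamma delta w l : R} {x y : R -> R}.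
Hypothesis sol : is_solution alpha beta gamma delta x y.
Hypotheses (alpha_gt0 : 0 < alpha) (delta_gt0 : 0 < delta).
Hypotheses (w_gt0 : 0 < w) (l_gt0 : 0 < l).
Hypotheses (eq1 : alpha + beta * w = l * w) (eq2 : gamma + delta * w = l).
Let mu := @lebesgue_measure R.
Let U t := \int[mu]_(s in `[0, t]) (x s)^-1.
Let V t := \int[mu]_(s in `[0, t]) (y s)^-1.
(** The second eigenvalue: the trace [beta + gamma] minus [l]. *)
Let m := beta - delta * w.
Let P t := V t - w * U t.
Let Q t := delta * V t + alpha / w * U t.

Let sol' := is_solution_swap _ _ _ _ _ _ _ sol.

Let xE t : 0 <= t -> x t = alpha * U t + beta * V t.
Proof. exact: (sol_eq_x sol). Qed.

Let yE t : 0 <= t -> y t = gamma * U t + delta * V t.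
Proof. exact: (sol_eq_y sol). Qed.

Let wn0 : w != 0. Proof. by rewrite gt_eqF. Qed.

Let alphaE : alpha = (l - beta) * w. Proof. by move: eq1; lra. Qed.

(** Since P' = 1/y - w/x = (x - w y) / (xy), this is the equation P' = m P / (xy) with denominators
    cleared; [QE] does the same for Q. *)
Let PE t : 0 <= t -> x t - w * y t = m * P t.
Proof. by move=> t0; rewrite xE// yE// /m /P alphaE -eq2; ring. Qed.

Let QE t : 0 <= t -> delta * x t + alpha / w * y t = l * Q t.
Proof.
by move=> t0; rewrite xE// yE// /Q alphaE -eq2; field.
Qed.

Let U00 : U 0 = 0. Proof. exact: sol_inv_integral0. Qed.

Let V00 : V 0 = 0. Proof. exact: sol_inv_integral0. Qed.

(** Here x and y may vanish on a null set, so the integral sign principle is applied to P and to -P,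
    encoded by [e]. *)
Lemma sol_ratio_le0 t : m <= 0 -> 0 <= t -> P t = 0.
Proof.
move=> m0 t0.
suff le0 e : (e = 1) \/ (e = -1) -> e * P t <= 0.
  by apply/eqP; rewrite eq_le -[P t]mul1r le0 ?mul1r; [|left];
    rewrite // -oppr_le0 -mulN1r le0//; right.
move=> eE.
pose f s := e * ((y s)^-1 - w * (x s)^-1).
have intf s : 0 <= s -> mu.-integrable `[0, s] (EFin \o f) /\
    \int[mu]_(r in `[0, s]) f r = e * P s.
  move=> s0.
  have ix := sol_inv_integrable sol _ s0.
  have iy := sol_inv_integrable sol' _ s0.
  have ms : measurable (`[0, s] : set (measurableTypeR R)) by exact: measurable_itv.
  have iwx : mu.-integrable `[0, s] (EFin \o (fun r => w * (x r)^-1)).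
    exact: (integrableZl ms w ix).
  have iP : mu.-integrable `[0, s] (EFin \o (fun r => (y r)^-1 - w * (x r)^-1)).
    exact: (integrableB ms iy iwx).
  split; first exact: (integrableZl ms e iP).
  by rewrite /f RintegralZl// RintegralB// RintegralZl.
have [intt <-] := intf t t0.
(* Off the zeros of x and y, the integrand [f] equals m (e P) / (xy), which is nonpositive wherever
   e P > 0. *)
apply: (@Rintegral_le0_sign _ _ ((`[0, t] `&` [set s | x s = 0]) `|`
  (`[0, t] `&` [set s | y s = 0]))) => //.
- apply: measurableU; first exact: sol_zero_measurable sol _.
  exact: sol_zero_measurable sol' _.
- apply/negligibleP.
    apply: measurableU; first exact: sol_zero_measurable sol _.
    exact: sol_zero_measurable sol' _.
  apply: negligibleU; apply/negligibleP.
  + exact: sol_zero_measurable sol _.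
  + exact: sol_zero_x sol _ t0.
  + exact: sol_zero_measurable sol' _.
  + exact: sol_zero_y sol _ t0.
move=> s /andP[s0 st] nz; rewrite (intf s s0).2 => Ps.
have ss : `[0, t]%classic s by rewrite /= in_itv/= s0.
have x0 : 0 < x s.
  rewrite lt_neqAle (sol_ge0_x sol)// andbT eq_sym; apply/negP => /eqP h.
  by apply: nz; left.
have y0 : 0 < y s.
  rewrite lt_neqAle (sol_ge0_y sol)// andbT eq_sym; apply/negP => /eqP h.
  by apply: nz; right.
have -> : f s = m * (e * P s) / (x s * y s).
  by rewrite mulrCA -PE// /f; field; rewrite !gt_eqF.
by rewrite ler_pdivrMr ?mulr_gt0// mul0r mulr_le0_ge0// ltW.
Qed.

(** The equation for P alone would allow growth away from 0, so P is compared with Q: (P / Q)' = (m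
    - l) (P / Q) / (xy), a decay strong enough, after raising to a large power, to beat the growth
    of Q. *)
Lemma sol_ratio_gt0 t : 0 < m -> 0 < t -> P t = 0.
Proof.
move=> m0 t0.
have b0 : 0 < beta.
  have -> : beta = m + delta * w by rewrite /m; ring.
  by rewrite addr_gt0// mulr_gt0.
have g0 : 0 < gamma.
  have -> : gamma = m + alpha / w; last by rewrite addr_gt0 ?divr_gt0.
  by rewrite alphaE mulfK// /m -eq2; ring.
have U0 s : 0 < s -> 0 < U s by exact: sol_inv_integral_gt0 sol _.
have V0 s : 0 < s -> 0 < V s by exact: sol_inv_integral_gt0 sol' _.
have x0 s : 0 < s -> 0 < x s.
  by move=> s0; rewrite xE ?ltW// addr_gt0// mulr_gt0// ?U0 ?V0.
have y0 s : 0 < s -> 0 < y s.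
  by move=> s0; rewrite yE ?ltW// addr_gt0// mulr_gt0// ?U0 ?V0.
have Q0 s : 0 < s -> 0 < Q s.
  by move=> s0; rewrite addr_gt0// !mulr_gt0 ?invr_gt0// ?U0 ?V0.
have dU (s : R) : 0 < s -> is_derive s 1 U (x s)^-1.
  by move=> s0; apply: (sol_inv_integral_derive sol) => //; exact: x0.
have dV (s : R) : 0 < s -> is_derive s 1 V (y s)^-1.
  by move=> s0; apply: (sol_inv_integral_derive sol') => //; exact: y0.
have dP (s : R) : 0 < s -> is_derive s 1 P (m * P s / (x s * y s)).
  move=> s0; have dUs := dU s s0; have dVs := dV s s0.
  apply: (@is_derive_eq _ _ _ _ _ _ _ _ (is_deriveB dVs (is_deriveZ w dUs))).
  rewrite -PE ?ltW// /GRing.scale/=.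
  by field; rewrite !gt_eqF// ?x0 ?y0.
have dQ (s : R) : 0 < s -> is_derive s 1 Q (l * Q s / (x s * y s)).
  move=> s0; have dUs := dU s s0; have dVs := dV s s0.
  apply: (@is_derive_eq _ _ _ _ _ _ _ _
    (is_deriveD (is_deriveZ delta dVs) (is_deriveZ (alpha / w) dUs))).
  rewrite -QE ?ltW// /GRing.scale/=.
  by field; rewrite wn0 !gt_eqF// ?x0 ?y0.
have lm : 0 < l - m.
  have -> : l - m = alpha / w + delta * w; last by rewrite addr_gt0// ?divr_gt0 ?mulr_gt0.
  by rewrite alphaE mulfK// /m; ring.
(* Chosen so that n (l - m) >= l, which makes the coefficient 2n (m - l) + l in [dG] nonpositive.
   The even exponent [n.*2] keeps [G] nonnegative. *)
pose n := (Num.truncn (l / (l - m))).+1.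
have nP : l <= n%:R * (l - m).
  by rewrite -ler_pdivrMr// ltW// truncnS_gt.
pose G s := (P s / Q s) ^+ n.*2 * Q s.
have G0 s : 0 < s -> 0 <= G s.
  by move=> s0; rewrite mulr_ge0 ?(ltW (Q0 s s0))// -mul2n exprM exprn_ge0// sqr_ge0.
pose dG s := ((n.*2)%:R * (m - l) + l) * G s / (x s * y s).
have dGP (s : R) : 0 < s -> is_derive s 1 G (dG s).
  move=> s0; have dPs := dP s s0; have dQs := dQ s s0.
  have Qn0 : Q s != 0 by rewrite gt_eqF// Q0.
  have dq := is_deriveM dPs (is_deriveV Qn0 dQs).
  have dqn := is_deriveX n.*2 dq.
  have -> : G = (P * (fun s => (Q s)^-1)) ^+ n.*2 * Q.
    by apply/funext => r; rewrite /G /= !fctE.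
  apply: (@is_derive_eq _ _ _ _ _ _ _ _ (is_deriveM dqn dQs)).
  rewrite /dG /G /GRing.scale/= !fctE doubleS/= !exprS.
  by field; rewrite Qn0 !gt_eqF// ?x0 ?y0.
have Gdecr s : 0 < s -> s < t -> G t <= G s.
  move=> s0 st; rewrite -subr_le0.
  have pos r : r \in `[s, t]%R -> 0 < r.
    by rewrite in_itv/= => /andP[sr _]; exact: lt_le_trans sr.
  have [r||r rst ->] := @MVT_segment _ G dG s t (ltW st).
  - by move=> rst; apply/dGP/pos; exact: subset_itv_oo_cc rst.
  - by apply: derivable_within_continuous => r /pos/dGP[].
  rewrite mulr_le0_ge0 ?subr_ge0 ?(ltW st)//.
  have r0 := pos r rst.
  rewrite /dG mulr_le0_ge0 ?invr_ge0 ?mulr_ge0 ?(ltW (x0 r r0)) ?(ltW (y0 r r0))//.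
  rewrite mulr_le0_ge0 ?G0//.
  have : 0 <= n%:R * (l - m) by rewrite mulr_ge0// ltW.
  by rewrite -mul2n natrM; move: nP; lra.
(* A bound for |P| / Q: |P| <= V + w U, while V <= Q / delta and w U <= (w^2 / alpha) Q. *)
pose C := delta^-1 + w ^+ 2 / alpha.
have C0 : 0 < C by rewrite addr_gt0 ?invr_gt0// divr_gt0// exprn_gt0.
have GC s : 0 < s -> G s <= C ^+ n.*2 * Q s.
  move=> s0; rewrite /G ler_pM2r ?Q0//.
  have even r : r ^+ n.*2 = `|r| ^+ n.*2 :> R.
    by rewrite -mul2n !exprM real_normK// num_real.
  rewrite even lerXn2r ?nnegrE ?(ltW C0)//.
  rewrite normrM normfV (gtr0_norm (Q0 s s0)) ler_pdivrMr ?Q0//.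
  have -> : C * Q s = V s + w * U s +
      (w ^+ 2 * delta / alpha * V s + alpha / (delta * w) * U s).
    by rewrite /C /Q; field; rewrite wn0 !gt_eqF.
  have US := ltW (U0 s s0); have VS := ltW (V0 s s0).
  rewrite (le_trans (ler_normB _ _))// normrM !ger0_norm ?(ltW w_gt0)//.
  by rewrite lerDl addr_ge0// mulr_ge0// ltW// ?divr_gt0 ?mulr_gt0 ?exprn_gt0.
have Qcvg : Q s @[s --> 0^'+] --> 0.
  have cU := sol_inv_integral_continuous sol _ (ltW t0).
  have cV := sol_inv_integral_continuous sol' _ (ltW t0).
  have [_ cU0 _] := (continuous_within_itvP _ t0).1 cU.
  have [_ cV0 _] := (continuous_within_itvP _ t0).1 cV.
  suff : Q s @[s --> 0^'+] --> delta * V 0 + alpha / w * U 0.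
    by rewrite U00 V00 !mulr0 addr0.
  exact: (cvgD (cvgM (cvg_cst delta) cV0) (cvgM (cvg_cst (alpha / w)) cU0)).
have : G t = 0.
  apply/eqP; rewrite eq_le G0// andbT leNgt; apply/negP => Gt.
  have e0 : 0 < G t / C ^+ n.*2 by rewrite divr_gt0// exprn_gt0.
  (* Near 0 such an [s] exists because Q tends to 0; then G t <= G s <= C^(2n) Q s < G t, a
     contradiction. *)
  have [s [Qs s0 st]] : exists s, [/\ Q s < G t / C ^+ n.*2, 0 < s & s < t].
    near (0 : R)^'+ => s; exists s; split.
    - by near: s; apply: (cvgr_lt _ Qcvg).
    - by near: s; exact: nbhs_right_gt.
    - by near: s; exact: nbhs_right_lt.
  have := le_trans (Gdecr s s0 st) (GC s s0).
  by rewrite leNgt mulrC -ltr_pdivlMr ?exprn_gt0// Qs.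
move/eqP; rewrite mulf_eq0 (gt_eqF (Q0 t t0)) orbF expf_eq0 => /andP[_].
by rewrite mulf_eq0 invr_eq0 (gt_eqF (Q0 t t0)) orbF => /eqP.
Unshelve. all: by end_near. Qed.

Lemma sol_sqrt t : 0 <= t ->
  x t = Num.sqrt (2 * (l * w)) * Num.sqrt t /\
  y t = Num.sqrt (2 * (l / w)) * Num.sqrt t.
Proof.
move=> t0.
have VE s : 0 <= s -> V s = w * U s.
  move=> s0; apply/eqP; rewrite -subr_eq0 -/(P s); apply/eqP.
  have [m0|m0] := leP m 0; first exact: sol_ratio_le0.
  move: s0; rewrite le_eqVlt => /predU1P[<-|s0]; last exact: sol_ratio_gt0.
  by rewrite /P U00 V00 mulr0 subr0.
have xU s : 0 <= s -> x s = l * w * U s.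
  by move=> s0; rewrite xE// VE// -eq1; ring.
have yU s : 0 <= s -> y s = l * U s.
  by move=> s0; rewrite yE// VE// -eq2; ring.
have lw0 : 0 < l * w by rewrite mulr_gt0.
have x0 s : 0 < s -> 0 < x s.
  by move=> s0; rewrite xU ?ltW// mulr_gt0// (sol_inv_integral_gt0 sol).
(* U behaves like sqrt t at 0, while U^2 has constant derivative 2 U / x = 2 / (l w); the mean value
   theorem then gives U^2 exactly. *)
have dU2 (s : R) : s \in `]0, t[%R -> is_derive s 1 (U ^+ 2) (2 / (l * w)).
  rewrite in_itv/= => /andP[s0 _].
  have dU : is_derive s 1 U (x s)^-1.
    by apply: (sol_inv_integral_derive sol) => //; exact: x0.
  apply: (@is_derive_eq _ _ _ _ _ _ _ _ (is_deriveX 2 dU)).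
  rewrite /GRing.scale/= xU ?ltW//.
  by field; rewrite wn0 !gt_eqF// (sol_inv_integral_gt0 sol).
have cU2 : {within `[0, t], continuous (U ^+ 2)}.
  have cU := sol_inv_integral_continuous sol _ t0.
  by move=> s; apply: continuousM; exact: cU.
have [_ _] := MVT_segment (df := fun=> 2 / (l * w)) t0 dU2 cU2.
rewrite !fctE U00 expr0n/= !subr0 => U2.
have UE : U t = Num.sqrt (2 / (l * w) * t).
  by rewrite -U2 sqrtr_sqr ger0_norm// (sol_inv_integral_ge0 sol).
have p0 : 0 <= 2 * (l * w) by rewrite mulr_ge0// ltW.
have q0 : 0 <= 2 * (l / w) by rewrite mulr_ge0// divr_ge0// ltW.
have absorb a b : 0 <= a -> a * Num.sqrt b = Num.sqrt (a ^+ 2 * b) :> R.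
  by move=> a0; rewrite sqrtrM ?sqr_ge0// sqrtr_sqr ger0_norm.
rewrite xU// yU// UE -!sqrtrM// !absorb ?(ltW lw0) ?(ltW l_gt0)//.
by split; congr Num.sqrt; field; rewrite wn0 gt_eqF.
Qed.

End ratio.

(** * Existence and uniqueness combined *)

Theorem proposition12 (R : realType) (alpha beta gamma delta : R)
    (alpha_gt0 : 0 < alpha) (delta_gt0 : 0 < delta)
    (hyp : 0 <= Num.max beta gamma \/ beta * gamma < alpha * delta) :
  is_solution alpha beta gamma delta
    (fun t => coef_c alpha beta gamma delta * Num.sqrt t)
    (fun t => coef_d alpha beta gamma delta * Num.sqrt t)
  /\
  (forall x y : R -> R, is_solution alpha beta gamma delta x y ->
     forall t : R, 0 <= t ->
       x t = coef_c alpha beta gamma delta * Num.sqrt t /\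
       y t = coef_d alpha beta gamma delta * Num.sqrt t).
Proof.
have [w [l [w0 l0 eq1 eq2 [-> ->]]]] :=
  coef_eigen _ _ _ _ _ alpha_gt0 delta_gt0 hyp.
split; last by move=> x y sol t t0; exact: sol_sqrt sol _ _ _ _ _ _ _ t0.
set d := Num.sqrt (2 * (l / w)).
have d0 : 0 < d by rewrite sqrtr_gt0 mulr_gt0// divr_gt0.
have dn0 : d != 0 by rewrite gt_eqF.
have wn0 : w != 0 by rewrite gt_eqF.
have d2 : d ^+ 2 = 2 * (l / w) by rewrite sqr_sqrtr// mulr_ge0// divr_ge0// ltW.
(* Writing l and c through w and d alone, with c = w d, leaves a single square root, so that both
   algebraic relations become rational identities. *)
have lE : l = w * d ^+ 2 / 2 by rewrite d2; field.
have -> : Num.sqrt (2 * (l * w)) = w * d.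
  rewrite [RHS](_ : _ = `|w * d|); last by rewrite ger0_norm// mulr_ge0// ltW.
  by rewrite -sqrtr_sqr exprMn d2; congr Num.sqrt; field.
apply: is_solution_sqrt => //; first by rewrite mulr_gt0.
- transitivity (2 / (w * d) * (alpha + beta * w)); last by field; rewrite wn0 dn0.
  by rewrite eq1 lE; field; rewrite wn0 dn0.
- transitivity (2 / (w * d) * (gamma + delta * w)); last by field; rewrite wn0 dn0.
  by rewrite eq2 lE; field; rewrite wn0 dn0.
Qed.
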